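(* Let $k,t$ be integers with $k\ge 2$ and $0\le t\le 2k-1$, and let $e=k(k-1)+t$. Then for any digraph $D\in\mathcal{D}(e)$, $$\rho(D)\le k-1+\frac{t}{2(k-1)}.$$
   Context: A simple digraph is a finite directed graph with no loops and no multiple arcs (a pair of opposite arcs $(u,v),(v,u)$ is allowed). The adjacency matrix $A(D)=(a_{ij})$ has $a_{ij}=1$ if there is an arc from $v_i$ to $v_j$ and $a_{ij}=0$ otherwise. The spectral radius $\rho(D)$ is the eigenvalue of $A(D)$ of largest modulus. $\mathcal{D}(e)$ is the set of all simple digraphs with exactly $e$ arcs (on any number of vertices). *)

(* Defs.v *)
From HB Require Import structures.
From mathcomp Require Import all_boot all_order all_algebra.
From mathcomp Require Import all_classical all_reals.
From mathcomp Require Export complex.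

Set Implicit Arguments.
Unset Strict Implicit.
Unset Printing Implicit Defensive.

Import Order.TTheory GRing.Theory Num.Theory.

Local Open Scope classical_set_scope.
Local Open Scope ring_scope.

(* A relation on the vertices rules out multiple arcs; opposite arcs are
   allowed since the relation need not be antisymmetric. *)
Record digraph (V : finType) := Digraph {
  arc :> rel V;
  arc_irreflexive : irreflexive arc
}.

Definition num_arcs (V : finType) (D : digraph V) : nat :=
  #|[set p : V * V | D p.1 p.2]%SET|.

Definition adjacency (K : nzRingType) (V : finType) (D : digraph V) :
    'M[K]_#|V| :=
  \matrix_(i, j) (D (enum_val i) (enum_val j))%:R.

Definition eigenvalue_moduli (R : realType) (n : nat) (A : 'M[R[i]]_n) :
    set R :=
  [set ComplexField.Normc.normc z | z in [set z : R[i] | eigenvalue A z]].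

(* For n = 0 there is no eigenvalue and the value is 0; for n > 0 the supremum
   is a maximum, by [spectral_radius_attained] and [spectral_radius_ge]. *)
Definition spectral_radius (R : realType) (n : nat) (A : 'M[R[i]]_n) : R :=
  sup (eigenvalue_moduli A).

Definition digraph_spectral_radius (R : realType) (V : finType)
    (D : digraph V) : R :=
  spectral_radius (adjacency R[i] D).

Lemma eigenvalue_moduli_max (R : realType) (n : nat) (A : 'M[R[i]]_n) :
  (0 < n)%N ->
  exists2 r, eigenvalue_moduli A r & ubound (eigenvalue_moduli A) r.
Proof.
move=> n_gt0.
have [s Ds] := closed_field_poly_normal (char_poly A).
have eigE z : eigenvalue A z = (z \in s).
  rewrite eigenvalue_root_char Ds (monicP (char_poly_monic A)) scale1r.
  by rewrite root_prod_XsubC.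
have sz_s : (0 < size s)%N.
  have := size_char_poly A.
  rewrite Ds (monicP (char_poly_monic A)) scale1r size_prod_XsubC.
  by case=> ->.
pose m (i : 'I_(size s)) : R := ComplexField.Normc.normc s`_i.
have [i _ maxi] := @arg_maxP _ _ _ (Ordinal sz_s) xpredT m isT.
exists (m i); first by exists s`_i => //=; rewrite eigE mem_nth.
move=> _ [z /= + <-]; rewrite eigE => /(nthP 0) [j lt_j <-].
exact: (maxi (Ordinal lt_j) isT).
Qed.

Lemma spectral_radius_attained (R : realType) (n : nat) (A : 'M[R[i]]_n) :
  (0 < n)%N ->
  exists2 z, eigenvalue A z & ComplexField.Normc.normc z = spectral_radius A.
Proof.
move=> n_gt0; have [r Ar ubr] := eigenvalue_moduli_max A n_gt0.
suff -> : spectral_radius A = r by case: Ar => z /= ? ?; exists z.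
apply/eqP; rewrite eq_le; apply/andP; split.
  by apply: ge_sup => //; exists r.
by apply: ub_le_sup => //; exists r.
Qed.

Lemma spectral_radius_ge (R : realType) (n : nat) (A : 'M[R[i]]_n) (z : R[i]) :
  (0 < n)%N -> eigenvalue A z ->
  ComplexField.Normc.normc z <= spectral_radius A.
Proof.
move=> n_gt0 Az; have [r _ ubr] := eigenvalue_moduli_max A n_gt0.
by apply: ub_le_sup; [exists r | exists z].
Qed.

(* Main.v *)
Require Import Defs.
From mathcomp Require Import all_boot all_order all_algebra.
From mathcomp Require Import all_classical all_reals.
From mathcomp Require Import ring lra.

(** The bound is a consequence of the digraph analogue
    [rho ^ 2 + rho <= e] of Stanley's inequality for graphs
    ([digraph_spectral_radius_quadratic]), since [x ^ 2 + x] already exceeds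
    [k (k - 1) + t] when [x > k - 1 + t / (2 (k - 1))].

    For the quadratic inequality, let [u] be the vector of moduli of an
    eigenvector for an eigenvalue of modulus [rho].  The triangle inequality
    gives [rho u <= u A] entrywise, hence [rho * N <= S] where [N] is the sum
    of the squares of [u] and [S] is the sum of [u x * u y] over the arcs
    [(x, y)].  It remains to bound [S].  Applying Cauchy-Schwarz to the sum
    over the tails and then to each out-neighbourhood, which misses its own
    centre because there is no loop, yields
    [S ^ 2 <= N (N e - sum of (u x) ^ 2 over the arcs (x, y))]
    ([quadratic_form_sqr_le]).  For a graph the last sum is symmetric in the
    two ends and at least [S]; for a digraph it need not be, but averaging
    with the same inequality for the reversed digraph replaces
    [(u x) ^ 2] by [((u x) ^ 2 + (u y) ^ 2) / 2 >= u x * u y].  So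
    [S ^ 2 + S N <= e N ^ 2], which gives the inequality for
    [rho <= S / N]. *)

Set Implicit Arguments.
Unset Strict Implicit.
Unset Printing Implicit Defensive.

Import Order.TTheory GRing.Theory Num.Theory.

Local Open Scope ring_scope.

Lemma sum_cauchy_schwarz (R : realFieldType) (I : finType) (P : pred I)
    (a b : I -> R) :
  (\sum_(i | P i) a i * b i) ^+ 2 <=
    (\sum_(i | P i) a i ^+ 2) * (\sum_(i | P i) b i ^+ 2).
Proof.
(* Lagrange's identity. *)
have : 0 <= \sum_(i | P i) \sum_(j | P j) (a i * b j - a j * b i) ^+ 2.
  by apply: sumr_ge0 => i _; apply: sumr_ge0 => j _; exact: sqr_ge0.
have -> : \sum_(i | P i) \sum_(j | P j) (a i * b j - a j * b i) ^+ 2 =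
    \sum_(i | P i) (a i ^+ 2 * (\sum_(j | P j) b j ^+ 2)
      - 2 * (a i * b i) * (\sum_(j | P j) a j * b j)
      + b i ^+ 2 * (\sum_(j | P j) a j ^+ 2)).
  apply: eq_bigr => i _; rewrite !mulr_sumr -sumrB -big_split /=.
  by apply: eq_bigr => j _; ring.
rewrite big_split sumrB /= -!mulr_suml -mulr_sumr.
by nra.
Qed.

(** Keeping the full weight [N] in place of the sum over an out-neighbourhood
    would only give [S ^ 2 <= N ^ 2 e]; the subtracted term comes from the
    absence of loops and is what produces the linear term of Stanley's
    inequality. *)
Lemma quadratic_form_sqr_le (R : realFieldType) (V : finType) (E : rel V)
    (u : V -> R) :
  irreflexive E ->
  (\sum_x \sum_(y | E x y) u x * u y) ^+ 2 <=
    (\sum_x u x ^+ 2) *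
      ((\sum_x u x ^+ 2) * (\sum_x \sum_(y | E x y) 1)
        - \sum_x \sum_(y | E x y) u x ^+ 2).
Proof.
move=> Eirr; set N := \sum_x u x ^+ 2.
under eq_bigr => x _ do rewrite -mulr_sumr.
apply: le_trans (sum_cauchy_schwarz _ _ _) _.
apply: ler_wpM2l; first by apply: sumr_ge0 => x _; exact: sqr_ge0.
rewrite mulr_sumr -sumrB; apply: ler_sum => x _.
have out_le : \sum_(y | E x y) u y ^+ 2 <= N - u x ^+ 2.
  rewrite /N [in leRHS](bigD1 x) //= [leRHS]addrC addKr.
  rewrite [leRHS](bigID (E x)) /= -[leLHS]addr0 lerD ?sumr_ge0 //.
    rewrite le_eqVlt; apply/orP; left; apply/eqP/eq_bigl => y.
    by case: eqVneq => [->|]; rewrite ?Eirr ?andbT.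
  by move=> y _; exact: sqr_ge0.
have := sum_cauchy_schwarz (E x) (fun=> 1) u.
under eq_bigr => y _ do rewrite mul1r.
under [X in _ <= X * _ -> _]eq_bigr => y _ do rewrite expr1n.
move=> /le_trans; apply.
have -> : \sum_(y | E x y) u x ^+ 2 = u x ^+ 2 * \sum_(y | E x y) 1.
  by rewrite mulr_sumr; apply: eq_bigr => y _; rewrite mulr1.
rewrite -mulrBl mulrC; apply: ler_wpM2r => //.
by apply: sumr_ge0 => y _; exact: ler01.
Qed.

Lemma sum_arcs (R : realFieldType) (V : finType) (D : digraph V) :
  \sum_x \sum_(y | D x y) 1 = (num_arcs D)%:R :> R.
Proof.
rewrite pair_big_dep /= sumr_const /num_arcs; congr (_ *+ _).
by apply: eq_card => p; rewrite [RHS]inE.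
Qed.

Lemma exchange_arcs (R : realFieldType) (V : finType) (E : rel V)
    (F : V -> V -> R) :
  \sum_x \sum_(y | E y x) F x y = \sum_x \sum_(y | E x y) F y x.
Proof. by rewrite (exchange_big_dep xpredT). Qed.

Lemma quadratic_form_digraph (R : realFieldType) (V : finType) (D : digraph V)
    (u : V -> R) (N := \sum_x u x ^+ 2)
    (S := \sum_x \sum_(y | D x y) u x * u y) :
  S ^+ 2 + S * N <= (num_arcs D)%:R * N ^+ 2.
Proof.
have tails := @quadratic_form_sqr_le _ V D u (@arc_irreflexive _ D).
have heads := @quadratic_form_sqr_le _ V (fun x y => D y x) u
  (@arc_irreflexive _ D).
rewrite (exchange_arcs D (fun x y => u x * u y))
  (exchange_arcs D (fun _ _ => 1))
  (exchange_arcs D (fun x _ => u x ^+ 2)) in heads.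
have S_rev : \sum_x \sum_(y | D x y) u y * u x = S.
  by apply: eq_bigr => x _; apply: eq_bigr => y _; rewrite mulrC.
rewrite S_rev in heads.
rewrite sum_arcs in tails heads; rewrite -/N -/S in tails heads.
have N_ge0 : 0 <= N by apply: sumr_ge0 => x _; exact: sqr_ge0.
have S_le : 2 * S <= \sum_x \sum_(y | D x y) u x ^+ 2 +
                     \sum_x \sum_(y | D x y) u y ^+ 2.
  rewrite -big_split mulr_sumr; apply: ler_sum => x _ /=.
  rewrite -big_split mulr_sumr; apply: ler_sum => y _ /=.
  by have := sqr_ge0 (u x - u y); nra.
have := ler_wpM2l N_ge0 S_le.
by lra.
Qed.

(** An eigenvector of moduli: by the triangle inequality the moduli [u] of an
    eigenvector satisfy [|z| u <= u A], and pairing with [u] turns this into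
    one scalar inequality. *)
Lemma eigenvalue_quadratic_form (R : realType) (V : finType) (D : digraph V)
    (z : R[i]) :
  eigenvalue (adjacency R[i] D) z ->
  exists2 u : V -> R, 0 < \sum_x u x ^+ 2 &
    ComplexField.Normc.normc z * (\sum_x u x ^+ 2) <=
      \sum_x \sum_(y | D x y) u x * u y.
Proof.
case/eigenvalueP => v vA v_neq0.
pose w (x : V) : R[i] := v 0 (enum_rank x).
have normc_ge0 (y : R[i]) : 0 <= ComplexField.Normc.normc y.
  by case: y => a b; exact: sqrtr_ge0.
have le_normc_sum (P : pred V) : ComplexField.Normc.normc (\sum_(x | P x) w x)
    <= \sum_(x | P x) ComplexField.Normc.normc (w x).
  elim/big_rec2: _ => [|x a b _ le_ab].
    by rewrite ComplexField.Normc.normc0.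
  by apply: le_trans (complex.le_normcD _ _) _; rewrite lerD2l.
exists (fun x => ComplexField.Normc.normc (w x)).
  have [i vi_neq0] : exists i, v 0 i != 0 by apply/rV0Pn.
  rewrite (bigD1 (enum_val i)) //= ltr_wpDr //.
    by apply: sumr_ge0 => x _; exact: sqr_ge0.
  rewrite exprn_gt0 // lt_def normc_ge0 andbT.
  apply: contra_neq vi_neq0; rewrite /w enum_valK.
  exact: ComplexField.Normc.eq0_normc.
rewrite -(exchange_arcs D (fun x y => _)) mulr_sumr.
apply: ler_sum => y _; rewrite -mulr_suml expr2 mulrA.
apply: ler_wpM2r => //.
rewrite -ComplexField.Normc.normcM.
suff -> : z * w y = \sum_(x | D x y) w x by exact: le_normc_sum.
move/rowP: vA => /(_ (enum_rank y)); rewrite !mxE -/(w y) => <-.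
rewrite (reindex (@enum_rank V)) /=; last exact/onW_bij/enum_rank_bij.
rewrite [RHS]big_mkcond; apply: eq_bigr => x _.
by rewrite mxE !enum_rankK -/(w x); case: (D x y); rewrite ?mulr1 ?mulr0.
Qed.

Lemma digraph_spectral_radius_quadratic (R : realType) (V : finType)
    (D : digraph V) (rho := digraph_spectral_radius R D) :
  (0 < #|V|)%N -> rho ^+ 2 + rho <= (num_arcs D)%:R.
Proof.
move=> V_gt0.
have [z z_eig z_max] := spectral_radius_attained (adjacency R[i] D) V_gt0.
have [u N_gt0] := eigenvalue_quadratic_form z_eig.
rewrite z_max -/(digraph_spectral_radius R D) -/rho.
have rho_ge0 : 0 <= rho.
  rewrite /rho /digraph_spectral_radius -z_max.
  by case: (z) => a b; exact: sqrtr_ge0.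
have /= := quadratic_form_digraph D u.
move: N_gt0; set N := \sum_x _; set S := \sum_x _ => N_gt0 quad rhoN_le.
rewrite -(ler_pM2r (exprn_gt0 2 N_gt0)); apply: le_trans quad.
have rhoN_ge0 : 0 <= rho * N by exact: mulr_ge0 rho_ge0 (ltW N_gt0).
by nra.
Qed.

Theorem corollary4p4 (R : realType) (k t : nat)
    (hk : (2 <= k)%N) (ht : (t <= 2 * k - 1)%N)
    (V : finType) (D : digraph V)
    (hD : num_arcs D = (k * (k - 1) + t)%N) :
  digraph_spectral_radius R D <= k%:R - 1 + t%:R / (2 * (k%:R - 1)).
Proof.
have V_gt0 : (0 < #|V|)%N.
  have : (0 < num_arcs D)%N by rewrite hD addn_gt0 muln_gt0 subn_gt0 hk ltnW.
  by case/card_gt0P => -[x _] _; apply/card_gt0P; exists x.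
have := digraph_spectral_radius_quadratic R D V_gt0.
rewrite hD natrD natrM natrB 1?ltnW //.
set rho := digraph_spectral_radius R D; set K : R := k%:R; set T : R := t%:R.
have K_ge2 : 2 <= K by rewrite (ler_nat R 2 k).
have T_ge0 : 0 <= T by exact: ler0n.
set d := T / _.
have Td : T = 2 * (K - 1) * d.
  by rewrite /d mulrC divfK // mulf_neq0 // ?subr_eq0; apply/eqP; lra.
have d_ge0 : 0 <= d by rewrite divr_ge0 // mulr_ge0 //; lra.
rewrite Td; clearbody d rho => quad.
rewrite leNgt; apply/negP => rho_gt.
have : (K - 1 + d) ^+ 2 < rho ^+ 2 by rewrite ltrXn2r // ?nnegrE //; lra.
by have := sqr_ge0 d; nra.
Qed.
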